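(* Let $\varphi:\mathbb{R}^n\to\mathbb{R}$ be of class $\mathcal{C}^{1,1}$ and let $x^0\in\mathbb{R}^n$ be such that, with $\Omega:=\{x\in\mathbb{R}^n\mid \varphi(x)\le\varphi(x^0)\}$: (1) for every $x\in\Omega$ the mapping $\partial^2\varphi(x)$ is positive-definite, i.e. $\langle z,u\rangle>0$ for all $u\neq 0$ and all $z\in\partial^2\varphi(x)(u)$; (2) $\Omega$ is bounded. Then every sequence $\{x^k\}$ generated by the Generalized Damped Newton Algorithm (with parameters $\sigma\in(0,\tfrac12)$, $\beta\in(0,1)$) from the starting point $x^0$ is convergent, and its limit is a tilt-stable local minimizer of $\varphi$.
   Context: A function $\varphi:\mathbb{R}^n\to\mathbb{R}$ is of class $\mathcal{C}^{1,1}$ if it is continuously differentiable and $\nabla\varphi$ is Lipschitz continuous around every point. For $\Omega\subset\mathbb{R}^s$ and $\bar z\in\Omega$, the regular normal cone is $\widehat N_\Omega(\bar z):=\{v\mid \limsup_{z\to\bar z,\,z\in\Omega}\langle v,z-\bar z\rangle/\|z-\bar z\|\le 0\}$ and the limiting normal cone $N_\Omega(\bar z)$ is the set of all $v$ for which there exist $z_k\to\bar z$ with $z_k\in\Omega$ and $v_k\to v$ with $v_k\in\widehat N_\Omega(z_k)$. For a set-valued map $F:\mathbb{R}^n\rightrightarrows\mathbb{R}^m$ and $(\bar x,\bar y)\in\operatorname{gph}F$, the coderivative is $D^*F(\bar x,\bar y)(v):=\{u\mid (u,-v)\in N_{\operatorname{gph}F}(\bar x,\bar y)\}$. For $\varphi$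 of class $\mathcal{C}^{1,1}$, the second-order subdifferential (generalized Hessian) is $\partial^2\varphi(x)(u):=D^*(\nabla\varphi)(x,\nabla\varphi(x))(u)$, $u\in\mathbb{R}^n$. A point $\bar x$ is a tilt-stable local minimizer of $\varphi$ if there is $\gamma>0$ such that the map $M_\gamma(v):=\operatorname{argmin}\{\varphi(x)-\langle v,x\rangle\mid x\in\mathbb{B}_\gamma(\bar x)\}$ is single-valued and Lipschitz continuous on a neighborhood of $0$ with $M_\gamma(0)=\{\bar x\}$. Generalized Damped Newton Algorithm: given $\sigma\in(0,\tfrac12)$, $\beta\in(0,1)$ and $x^0$, set $k=0$. If $\nabla\varphi(x^k)=0$ stop. Otherwise choose $d^k$ with $-\nabla\varphi(x^k)\in\partial^2\varphi(x^k)(d^k)$; set $\tau_k=1$ and, while $\varphi(x^k+\tau_kd^k)>\varphi(x^k)+\sigma\tau_k\langle\nabla\varphi(x^k),d^k\rangle$, replace $\tau_k$ by $\beta\tau_k$; set $x^{k+1}:=x^k+\tau_kd^k$, increase $k$ by 1 and repeat. *)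

(* Defs.v *)
From HB Require Import structures.
From mathcomp Require Import all_boot all_order all_algebra.
From mathcomp Require Import reals.
Set Implicit Arguments. Unset Strict Implicit. Unset Printing Implicit Defensive.
Import Order.TTheory GRing.Theory Num.Theory.
Local Open Scope ring_scope.

Section Defs.
Variable R : realType.

Definition dot {s : nat} (u v : 'rV[R]_s) : R := \sum_(i < s) u 0 i * v 0 i.
Definition enorm {s : nat} (u : 'rV[R]_s) : R := Num.sqrt (dot u u).

Definition seq_cvg {s : nat} (z : nat -> 'rV[R]_s) (l : 'rV[R]_s) : Prop :=
  forall eps : R, 0 < eps -> exists N : nat, forall k, (N <= k)%N -> enorm (z k - l) < eps.

Definition is_gradient {n : nat} (f : 'rV[R]_n -> R) (x g : 'rV[R]_n) : Prop :=
  forall eps : R, 0 < eps -> exists delta : R, 0 < delta /\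
    forall y, enorm (y - x) < delta ->
      `|f y - f x - dot g (y - x)| <= eps * enorm (y - x).

Definition C11 {n : nat} (phi : 'rV[R]_n -> R) (grad : 'rV[R]_n -> 'rV[R]_n) : Prop :=
  (forall x, is_gradient phi x (grad x)) /\
  (forall x, exists r : R, 0 < r /\ exists L : R,
      forall y z, enorm (y - x) < r -> enorm (z - x) < r ->
        enorm (grad y - grad z) <= L * enorm (y - z)).

(* regular normal cone: limsup_{z ->_Omega zb} <v, z - zb>/|z - zb| <= 0 *)
Definition regular_normal {s : nat} (Omega : 'rV[R]_s -> Prop) (zb v : 'rV[R]_s) : Prop :=
  forall eps : R, 0 < eps -> exists delta : R, 0 < delta /\
    forall z, Omega z -> enorm (z - zb) < delta ->
      dot v (z - zb) <= eps * enorm (z - zb).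

Definition limiting_normal {s : nat} (Omega : 'rV[R]_s -> Prop) (zb v : 'rV[R]_s) : Prop :=
  exists (zk vk : nat -> 'rV[R]_s),
    (forall k, Omega (zk k)) /\ (forall k, regular_normal Omega (zk k) (vk k)) /\
    seq_cvg zk zb /\ seq_cvg vk v.

Definition graph {n m : nat} (F : 'rV[R]_n -> 'rV[R]_m) : 'rV[R]_(n + m) -> Prop :=
  fun w => exists x, w = row_mx x (F x).

Definition coderiv {n m : nat} (F : 'rV[R]_n -> 'rV[R]_m) (x : 'rV[R]_n) (y v : 'rV[R]_m)
  (u : 'rV[R]_n) : Prop :=
  limiting_normal (graph F) (row_mx x y) (row_mx u (- v)).

Definition hess2 {n : nat} (grad : 'rV[R]_n -> 'rV[R]_n) (x u z : 'rV[R]_n) : Prop :=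
  coderiv grad x (grad x) u z.

Definition tilt_argmin {n : nat} (phi : 'rV[R]_n -> R) (gamma : R) (xb v x : 'rV[R]_n) : Prop :=
  enorm (x - xb) <= gamma /\
  forall y, enorm (y - xb) <= gamma -> phi x - dot v x <= phi y - dot v y.

Definition tilt_stable {n : nat} (phi : 'rV[R]_n -> R) (xb : 'rV[R]_n) : Prop :=
  exists gamma : R, 0 < gamma /\
  exists delta : R, 0 < delta /\
  exists (M : 'rV[R]_n -> 'rV[R]_n) (L : R),
    (forall v, enorm v < delta -> forall x, tilt_argmin phi gamma xb v x <-> x = M v) /\
    (forall v w, enorm v < delta -> enorm w < delta ->
        enorm (M v - M w) <= L * enorm (v - w)) /\
    M 0 = xb.

(* one step of the Generalized Damped Newton Algorithm: from xk to xk1.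
   If grad xk = 0 the algorithm stops; we encode the stopped sequence by
   repeating the final iterate forever. Otherwise a direction d with
   -grad xk \in d^2 phi(xk)(d) is chosen and tau = beta^j where j is the
   number of backtracking steps (first j with the Armijo condition). *)
Definition gdn_step {n : nat} (phi : 'rV[R]_n -> R) (grad : 'rV[R]_n -> 'rV[R]_n)
  (sigma beta : R) (xk xk1 : 'rV[R]_n) : Prop :=
  if grad xk == 0 then xk1 = xk else
  exists d : 'rV[R]_n, hess2 grad xk d (- grad xk) /\
  exists j : nat,
    (forall i, (i < j)%N ->
       phi (xk + beta ^+ i *: d) > phi xk + sigma * beta ^+ i * dot (grad xk) d) /\
    phi (xk + beta ^+ j *: d) <= phi xk + sigma * beta ^+ j * dot (grad xk) d /\
    xk1 = xk + beta ^+ j *: d.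

Definition gdn_sequence {n : nat} (phi : 'rV[R]_n -> R) (grad : 'rV[R]_n -> 'rV[R]_n)
  (sigma beta : R) (x0 : 'rV[R]_n) (xs : nat -> 'rV[R]_n) : Prop :=
  xs 0%N = x0 /\ forall k, gdn_step phi grad sigma beta (xs k) (xs k.+1).

End Defs.

(* Main.v *)
Require Import Defs.
From mathcomp Require Import all_boot all_order all_algebra.
From mathcomp Require Import reals interval_inference.
From mathcomp Require Import boolp classical_sets topology normedtype sequences.
From mathcomp Require Import derive realfun.
From mathcomp Require Import ring lra.
Set Implicit Arguments. Unset Strict Implicit. Unset Printing Implicit Defensive.
Import Order.TTheory GRing.Theory Num.Theory.
Import numFieldNormedType.Exports.
Local Open Scope classical_set_scope.
Local Open Scope ring_scope.

(** Positive definiteness of the generalized Hessian at a point [xb] of the level set is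
    robust: by compactness of unit normals, [<z, u> >= kappa |u|^2] for all limiting
    normals [(z, -u)] to the graph of [grad] at points near [xb]. For each [v], an
    approximate mean value inequality for the function [<v, grad>], whose regular
    subgradients are normals to the graph, turns this into strong monotonicity of [grad]
    near [xb]; if [xb] is stationary, tilt stability follows from the variational
    inequalities of the tilted problems.

    The iterates decrease [phi], so they stay in the bounded level set and have a cluster
    point [xb]. Backtracking stops at steps bounded away from 0 near [xb], so each step
    from there decreases [phi] by at least a multiple of [|grad|^2], which forces
    [grad xb = 0]. Strong convexity then makes [phi - phi xb] a Lyapunov function that
    traps the iterates near [xb]. *)

Lemma addrKl (V : zmodType) (x y : V) : x + y - x = y.
Proof. by rewrite addrC addKr. Qed.

Section EuclideanNorm.
Variables (R : realType) (n : nat).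
Implicit Types (u v w x y : 'rV[R]_n) (a t : R).

Lemma dotC u v : dot u v = dot v u.
Proof. by apply: eq_bigr => i _; rewrite mulrC. Qed.

Lemma dotDl u v w : dot (u + v) w = dot u w + dot v w.
Proof. by rewrite /dot -big_split; apply: eq_bigr => i _; rewrite mxE mulrDl. Qed.

Lemma dotZl a u v : dot (a *: u) v = a * dot u v.
Proof. by rewrite /dot mulr_sumr; apply: eq_bigr => i _; rewrite mxE mulrA. Qed.

Lemma dotNl u v : dot (- u) v = - dot u v.
Proof. by rewrite -scaleN1r dotZl mulN1r. Qed.

Lemma dotBl u v w : dot (u - v) w = dot u w - dot v w.
Proof. by rewrite dotDl dotNl. Qed.

Lemma dotDr u v w : dot w (u + v) = dot w u + dot w v.
Proof. by rewrite dotC dotDl !(dotC w). Qed.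

Lemma dotZr a u v : dot v (a *: u) = a * dot v u.
Proof. by rewrite dotC dotZl dotC. Qed.

Lemma dotNr u v : dot v (- u) = - dot v u.
Proof. by rewrite dotC dotNl dotC. Qed.

Lemma dotBr u v w : dot w (u - v) = dot w u - dot w v.
Proof. by rewrite dotDr dotNr. Qed.

Lemma dot0l u : dot 0 u = 0.
Proof. by rewrite -(scale0r u) dotZl mul0r. Qed.

Lemma dot0r u : dot u 0 = 0.
Proof. by rewrite dotC dot0l. Qed.

Lemma dot_sqrD u v : dot (u + v) (u + v) = dot u u + 2 * dot u v + dot v v.
Proof. by rewrite dotDl !dotDr (dotC v u); ring. Qed.

Lemma dot_ge0 u : 0 <= dot u u.
Proof. by apply: sumr_ge0 => i _; rewrite -expr2 sqr_ge0. Qed.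

Lemma sqr_enorm u : enorm u ^+ 2 = dot u u.
Proof. by rewrite sqr_sqrtr // dot_ge0. Qed.

Lemma enorm_ge0 u : 0 <= enorm u.
Proof. exact: sqrtr_ge0. Qed.

Lemma enorm0 : enorm (0 : 'rV[R]_n) = 0.
Proof. by rewrite /enorm dot0l sqrtr0. Qed.

Lemma enorm_subrr u : enorm (u - u) = 0.
Proof. by rewrite subrr enorm0. Qed.

Lemma coord_le_enorm u i : `|u 0 i| <= enorm u.
Proof.
rewrite -sqrtr_sqr ler_sqrt ?dot_ge0 // /dot (bigD1 i) //= -expr2 lerDl.
by apply: sumr_ge0 => j _; rewrite -expr2 sqr_ge0.
Qed.

Lemma enorm_eq0 u : (enorm u == 0) = (u == 0).
Proof.
apply/eqP/eqP => [u0|->]; last exact: enorm0.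
by apply/rowP => i; apply/eqP; rewrite mxE -normr_le0 -u0 coord_le_enorm.
Qed.

Lemma enorm_gt0 u : (0 < enorm u) = (u != 0).
Proof. by rewrite lt0r enorm_ge0 andbT enorm_eq0. Qed.

Lemma enormZ a u : enorm (a *: u) = `|a| * enorm u.
Proof. by rewrite /enorm dotZl dotZr mulrA -expr2 sqrtrM ?sqr_ge0 // sqrtr_sqr. Qed.

Lemma enormN u : enorm (- u) = enorm u.
Proof. by rewrite -scaleN1r enormZ normrN1 mul1r. Qed.

Lemma enorm_distC u v : enorm (u - v) = enorm (v - u).
Proof. by rewrite -enormN opprB. Qed.

Lemma dot_le_enorm u v : dot u v <= enorm u * enorm v.
Proof.
have [->|u0] := eqVneq u 0; first by rewrite dot0l enorm0 mul0r.
have [->|v0] := eqVneq v 0; first by rewrite dot0r enorm0 mulr0.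
have : 0 < enorm u * enorm v by rewrite mulr_gt0 ?enorm_gt0.
have := dot_ge0 (enorm v *: u - enorm u *: v).
rewrite dotBl !dotBr !dotZl !dotZr (dotC v u) -!sqr_enorm => diff_ge0 norms_gt0.
by rewrite -(ler_pM2l norms_gt0); nra.
Qed.

Lemma ler_enormD u v : enorm (u + v) <= enorm u + enorm v.
Proof.
rewrite -(ler_pXn2r (n := 2)) ?nnegrE ?addr_ge0 ?enorm_ge0 //.
rewrite sqr_enorm dot_sqrD -!sqr_enorm.
by have := dot_le_enorm u v; nra.
Qed.

Lemma ler_dist_enormD u v w : enorm (u - w) <= enorm (u - v) + enorm (v - w).
Proof. by have := ler_enormD (u - v) (v - w); rewrite subrKA. Qed.

Lemma enorm_segment_le x y w t : 0 <= t <= 1 ->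
  enorm (x + t *: (y - x) - w) <= Num.max (enorm (x - w)) (enorm (y - w)).
Proof.
move=> /andP[t0 t1].
have -> : x + t *: (y - x) - w = (1 - t) *: (x - w) + t *: (y - w).
  by apply/rowP => i; rewrite !mxE; ring.
apply: le_trans (ler_enormD _ _) _; rewrite !enormZ !ger0_norm ?subr_ge0 //.
set m := Num.max _ _; rewrite (_ : m = (1 - t) * m + t * m); last by ring.
by apply: lerD; rewrite ler_wpM2l ?subr_ge0 // le_max lexx ?orbT.
Qed.

End EuclideanNorm.

Section RowBlocks.
Variables (R : realType) (m n : nat).
Implicit Types (a c : 'rV[R]_m) (b d : 'rV[R]_n).

Lemma dot_row_mx a b c d : dot (row_mx a b) (row_mx c d) = dot a c + dot b d.
Proof.
by rewrite /dot big_split_ord; congr (_ + _); apply: eq_bigr => i _;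
  rewrite ?row_mxEl ?row_mxEr.
Qed.

Lemma sub_row_mx a b c d : row_mx a b - row_mx c d = row_mx (a - c) (b - d).
Proof. by rewrite opp_row_mx add_row_mx. Qed.

Lemma enorm_row_mx_le a b : enorm (row_mx a b) <= enorm a + enorm b.
Proof.
rewrite -(ler_pXn2r (n := 2)) ?nnegrE ?addr_ge0 ?enorm_ge0 //.
rewrite sqr_enorm dot_row_mx -!sqr_enorm.
by have := enorm_ge0 a; have := enorm_ge0 b; nra.
Qed.

Lemma enorm_le_row_mx a b : enorm a <= enorm (row_mx a b).
Proof. by rewrite ler_sqrt ?dot_ge0 // dot_row_mx lerDl dot_ge0. Qed.

End RowBlocks.

Section EuclideanTopology.
Variables (R : realType) (n : nat).
Implicit Types (u v x y : 'rV[R]_n) (e M : R).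

Lemma mx_norm_le_enorm u : `|u| <= enorm u.
Proof.
rewrite [`|u|]/Num.norm /= mx_normrE; apply/bigmax_leP; split; first exact: enorm_ge0.
by move=> [i j] _ /=; rewrite (ord1 i) coord_le_enorm.
Qed.

Lemma enorm_le_mx_norm u : enorm u <= Num.sqrt n%:R * `|u|.
Proof.
rewrite -[`|u|](@ger0_norm R) // -sqrtr_sqr -sqrtrM // ler_sqrt ?mulr_ge0 ?sqr_ge0 //.
apply: (@le_trans _ _ (\sum_(i < n) `|u| ^+ 2)); last first.
  by rewrite sumr_const card_ord mulr_natl.
apply: ler_sum => i _; rewrite -expr2 -real_normK ?num_real // lerXn2r ?nnegrE //.
by rewrite [leRHS]/Num.norm /= mx_normrE; apply/bigmax_geP; right; exists (0, i).
Qed.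

Lemma nbhs_enormP x (P : set 'rV[R]_n) :
  nbhs x P <-> exists2 e, 0 < e & forall y, enorm (y - x) < e -> P y.
Proof.
split=> [/nbhs_normP[e /= e0 xeP]|[e e0 xeP]].
  exists e => // y yx; apply: xeP => /=; apply: le_lt_trans yx.
  by rewrite enorm_distC mx_norm_le_enorm.
apply/(nbhs_normP x P); exists (e / (Num.sqrt n%:R + 1)) => /= [|y /= xy].
  by rewrite divr_gt0 // ltr_wpDl ?sqrtr_ge0.
apply: xeP; rewrite enorm_distC; apply: le_lt_trans (enorm_le_mx_norm _) _.
move: xy; rewrite ltr_pdivlMr ?ltr_wpDl ?sqrtr_ge0 //; apply: le_lt_trans.
by rewrite mulrC ler_wpM2l // lerDl.
Qed.

Lemma seq_cvgP (z : nat -> 'rV[R]_n) x : seq_cvg z x <-> z @ \oo --> x.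
Proof.
split=> [zx P /nbhs_enormP[e e0 xeP]|zx e e0].
  by have [N zN] := zx e e0; exists N => // k /zN /xeP.
have [|N _ zN] := zx [set y | enorm (y - x) < e]; first by apply/nbhs_enormP; exists e.
by exists N => k /zN.
Qed.

Lemma cvg_dot {T : Type} {F : set_system T} {FF : Filter F} (f g : T -> 'rV[R]_n) x y :
  f @ F --> x -> g @ F --> y -> dot (f t) (g t) @[t --> F] --> dot x y.
Proof.
have coord (h : T -> 'rV[R]_n) (z : 'rV[R]_n) i :
    h @ F --> z -> h t 0 i @[t --> F] --> z 0 i.
  by move=> hz; exact: (continuous_cvg _ (@coord_continuous R 1 n 0 i z) hz).
move=> fx gy; apply: (@cvg_big R^o); first exact: (@add_continuous R^o).
by move=> i _; apply: cvgM; exact: coord.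
Qed.

Lemma continuous_dot v : continuous (dot v).
Proof. by move=> x; exact: (@cvg_dot _ (nbhs x) _ (fun=> v) id v x (cvg_cst v) cvg_id). Qed.

Lemma cvg_enorm {T : Type} {F : set_system T} {FF : Filter F} (f : T -> 'rV[R]_n) x :
  f @ F --> x -> enorm (f t) @[t --> F] --> enorm x.
Proof. by move=> fx; apply: continuous_cvg (cvg_dot fx fx); exact: sqrt_continuous. Qed.

Lemma continuous_enormB y : continuous (fun x => enorm (x - y)).
Proof. by move=> x; exact: (cvg_enorm (cvgB cvg_id (cvg_cst y))). Qed.

Lemma near_enorm_lt x y e : enorm (x - y) < e -> \forall z \near x, enorm (z - y) < e.
Proof. exact: (cvgr_lt _ (continuous_enormB (y := y) (x := x))). Qed.

Lemma near_enorm_center x e : 0 < e -> \forall z \near x, enorm (z - x) < e.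
Proof. by move=> e0; apply: near_enorm_lt; rewrite enorm_subrr. Qed.

Lemma near_enorm_scaled_lt x C e : 0 < e -> \forall y \near x, C * enorm (y - x) < e.
Proof.
move=> e0; have C0 : 0 < `|C| + 1 by rewrite ltr_wpDl.
apply: filterS (near_enorm_center x (divr_gt0 e0 C0)) => y.
rewrite ltr_pdivlMr // mulrC; apply: le_lt_trans.
by rewrite ler_wpM2r ?enorm_ge0 // ler_wpDr // ler_norm.
Qed.

Lemma near_lipschitz_continuous (V : normedModType R) (f : 'rV[R]_n -> V) x C :
  (\forall y \near x, `|f y - f x| <= C * enorm (y - x)) -> {for x, continuous f}.
Proof.
move=> fC; apply/(@cvgrPdistC_le _ _ _ (nbhs x)) => e e0.
by apply: filterS2 fC (near_enorm_scaled_lt x C e0) => y fy /ltW; exact: le_trans.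
Qed.

Lemma near_line x v (P : set 'rV[R]_n) :
  (\forall y \near x, P y) -> \forall t \near (0 : R), P (x + t *: v).
Proof.
have := cvgD (cvg_cst x) (@scalel_continuous R 'rV[R]_n v 0).
by rewrite scale0r addr0; apply.
Qed.

Lemma compact_enorm_ball x M : compact [set y | enorm (y - x) <= M].
Proof.
apply: bounded_closed_compact.
  exists (M + enorm x); split=> [|b Mb y /= yM]; first exact: num_real.
  apply: le_trans (mx_norm_le_enorm y) (ltW (le_lt_trans _ Mb)).
  by have := ler_enormD (y - x) x; rewrite subrK; lra.
apply: (closed_comp (f := fun y => enorm (y - x)) (D := [set t | t <= M])).
  by move=> y _; exact: continuous_enormB.
exact: closed_le.
Qed.

Lemma cvg_enorm_harmonic (z : nat -> 'rV[R]_n) x :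
  (forall k, enorm (z k - x) < k.+1%:R^-1) -> z @ \oo --> x.
Proof.
move=> zx; apply/seq_cvgP => e e0; have [N _ Ne] := near_infty_natSinv_lt (PosNum e0).
by exists N => k /Ne; exact: lt_trans.
Qed.

Lemma bounded_cvg_subseq (z : nat -> 'rV[R]_n) M : (forall k, enorm (z k) <= M) ->
  exists x, exists2 g : nat -> nat, g @ \oo --> \oo & z \o g @ \oo --> x.
Proof.
move=> zM; have [|x [_ zx]] := @compact_enorm_ball 0 M (z @ \oo) _.
  by exists 0%N => // k _ /=; rewrite subr0.
have /choice[g /all_and2[le_g zg]] k : exists j, (k <= j)%N /\ enorm (z j - x) < k.+1%:R^-1.
  have [||_ [[j kj <-] jx]] :=
    zx (z @` [set j | (k <= j)%N]) [set y | enorm (y - x) < k.+1%:R^-1].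
  - by exists k => // j /= kj; exists j.
  - by apply: near_enorm_center; rewrite invr_gt0.
  - by exists j.
exists x, g; last exact: cvg_enorm_harmonic.
by move=> P [N _ NP]; exists N => // k /= Nk; apply: NP => /=; exact: leq_trans (le_g k).
Qed.

End EuclideanTopology.

Section RowBlockTopology.
Variables (R : realType) (m n : nat).

Lemma cvg_row_mx {T : Type} {F : set_system T} {FF : Filter F}
    (f : T -> 'rV[R]_m) (g : T -> 'rV[R]_n) (a : 'rV[R]_m) (b : 'rV[R]_n) :
  row_mx (f t) (g t) @[t --> F] --> row_mx a b <-> (f @ F --> a) /\ (g @ F --> b).
Proof.
split=> [fg|[fa gb] P /nbhs_enormP[e e0 abP]].
  have fE : (fun t => lsubmx (row_mx (f t) (g t))) = f.
    by apply/funext => t; rewrite row_mxKl.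
  have gE : (fun t => rsubmx (row_mx (f t) (g t))) = g.
    by apply/funext => t; rewrite row_mxKr.
  split; [rewrite -fE -(row_mxKl a b)|rewrite -gE -(row_mxKr a b)].
    exact: (continuous_cvg _ (@continuous_lsubmx R 1 m n (row_mx a b)) fg).
  exact: (continuous_cvg _ (@continuous_rsubmx R 1 m n (row_mx a b)) fg).
have e2 : 0 < e / 2 by rewrite divr_gt0.
suff : \forall t \near F, P (row_mx (f t) (g t)) by [].
near=> t; apply: abP; rewrite sub_row_mx; apply: le_lt_trans (enorm_row_mx_le _ _) _.
have : enorm (f t - a) < e / 2 by near: t; exact: (fa _ (near_enorm_center a e2)).
have : enorm (g t - b) < e / 2 by near: t; exact: (gb _ (near_enorm_center b e2)).
by lra.
Unshelve. all: by end_near. Qed.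

End RowBlockTopology.

Section Gradients.
Variables (R : realType) (n : nat).
Implicit Types (f : 'rV[R]_n -> R) (g x y v : 'rV[R]_n) (m t e : R).

Lemma is_gradient_near f x g e : is_gradient f x g -> 0 < e ->
  \forall y \near x, `|f y - f x - dot g (y - x)| <= e * enorm (y - x).
Proof. by move=> fg /fg[d [d0 fd]]; apply/nbhs_enormP; exists d. Qed.

Lemma is_gradientN f x g : is_gradient f x g -> is_gradient (fun y => - f y) x (- g).
Proof.
move=> fg e /fg[d [d0 fd]]; exists d; split=> // y /fd.
by rewrite dotNl -!opprD normrN.
Qed.

Lemma is_gradient_tilt f x g v : is_gradient f x g ->
  is_gradient (fun y => f y - dot v y) x (g - v).
Proof.
move=> fg e /fg[d [d0 fd]]; exists d; split=> // y /fd.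
rewrite (_ : f y - dot v y - _ - _ = f y - f x - dot g (y - x)) //.
by rewrite dotBl (dotBr y x v); ring.
Qed.

Lemma is_gradient_continuous f x g : is_gradient f x g -> {for x, continuous f}.
Proof.
move=> fg; apply: (@near_lipschitz_continuous _ _ R^o f x (enorm g + 1)).
apply: filterS (is_gradient_near fg ltr01) => y; rewrite !ler_norml => /andP[fy1 fy2].
have := dot_le_enorm g (y - x); have := dot_le_enorm (- g) (y - x).
by rewrite dotNl enormN => gy1 gy2; apply/andP; split; lra.
Qed.

Lemma is_gradient_dir_near f x g v e : is_gradient f x g -> 0 < e ->
  \forall t \near (0 : R), `|f (x + t *: v) - f x - t * dot g v| <= e * `|t|.
Proof.
move=> fg e0; have C0 : 0 < enorm v + 1 by rewrite ltr_wpDl ?enorm_ge0.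
apply: filterS (near_line v (is_gradient_near fg (divr_gt0 e0 C0))) => t.
rewrite addrKl dotZr enormZ => /le_trans; apply.
rewrite mulrCA mulrC ler_wpM2r // mulrAC ler_pdivrMr // ler_wpM2l ?(ltW e0) //.
by rewrite lerDl.
Qed.

Lemma is_derive_line f g x v t : is_gradient f (x + t *: v) g ->
  is_derive t 1 (fun s => f (x + s *: v)) (dot g v).
Proof.
set p := x + t *: v => fg.
suff D : h^-1 *: (((fun s => f (x + s *: v)) \o shift t) (h *: (1 : R)) - f p)
    @[h --> 0^'] --> dot g v.
  by apply: DeriveDef; [apply/cvg_ex; exists (dot g v)|exact: cvg_lim D].
apply/cvgrPdistC_le => e e0; rewrite near_withinE.
apply: filterS (is_gradient_dir_near v fg e0) => h /= fh h0.
have -> : x + (h *: 1 + t) *: v = p + h *: v.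
  by rewrite scalerDl [h *: 1]mulr1 addrCA addrC.
have {1}-> : dot g v = h^-1 * (h * dot g v) by rewrite mulKf.
by rewrite -mulrBr normrM normfV ler_pdivrMl ?normr_gt0 // [leRHS]mulrC.
Qed.

(* The mean value theorem for [t |-> f (x + t v) - m / 2 t^2 |v|^2] on [0, 1]. *)
Lemma gradient_quadratic_le f (df : 'rV[R]_n -> 'rV[R]_n) m x v :
  (forall y, is_gradient f y (df y)) ->
  (forall t, 0 < t < 1 -> m * t * dot v v <= dot (df (x + t *: v) - df x) v) ->
  dot (df x) v + m / 2 * dot v v <= f (x + v) - f x.
Proof.
move=> fdf dfm.
pose F t := f (x + t *: v) - (m / 2 * dot v v) * (t * t).
pose dF t := dot (df (x + t *: v)) v - m * t * dot v v.
have FdF t : is_derive t (1 : R) F (dF t).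
  have fv := is_derive_line (fdf (x + t *: v)).
  by apply: is_derive_eq; rewrite /dF /= /GRing.scale /=; field.
have [|c] := @MVT R F dF 0 1 ltr01 (fun t _ => FdF t).
  by apply: derivable_within_continuous => t _; have [] := FdF t.
rewrite in_itv /= => /dfm; rewrite /F /dF dotBl scale1r scale0r addr0; lra.
Qed.

Lemma is_gradient_dir_min f g x v : is_gradient f x g ->
  (\forall t \near (0 : R)^'+, f x <= f (x + t *: v)) -> 0 <= dot g v.
Proof.
move=> fg fmin; apply/ler_addgt0Pr => e e0.
near (0 : R)^'+ => t; have t0 : 0 < t by [].
have ft : f x <= f (x + t *: v) by near: t.
have : `|f (x + t *: v) - f x - t * dot g v| <= e * `|t|.
  by near: t; apply: cvg_within; exact: (is_gradient_dir_near v fg e0).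
rewrite (gtr0_norm t0) ler_norml => /andP[_ fg_t].
by rewrite -(pmulr_rge0 _ t0); lra.
Unshelve. all: by end_near. Qed.

End Gradients.

Section RegularSubgradient.
Variables (R : realType) (n : nat).
Implicit Types (f : 'rV[R]_n -> R) (x z : 'rV[R]_n) (l C : R).

Definition regular_subgradient f x z := forall e : R, 0 < e ->
  \forall y \near x, dot z (y - x) - e * enorm (y - x) <= f y - f x.

Lemma regular_subgradient_enorm_le f x z l : 0 <= l ->
  (\forall y \near x, f y - f x <= l * enorm (y - x)) ->
  regular_subgradient f x z -> enorm z <= l.
Proof.
move=> l0 fl fz; have [->|z0] := eqVneq z 0; first by rewrite enorm0.
apply/ler_addgt0Pr => e e0; have zp : 0 < enorm z by rewrite enorm_gt0.
near (0 : R)^'+ => t; have t0 : 0 < t by [].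
have : f (x + t *: z) - f x <= l * enorm (x + t *: z - x).
  by near: t; apply: cvg_within; exact: (near_line z fl).
have : dot z (x + t *: z - x) - e * enorm (x + t *: z - x) <= f (x + t *: z) - f x.
  by near: t; apply: cvg_within; exact: (near_line z (fz _ e0)).
rewrite addrKl dotZr enormZ (gtr0_norm t0) -sqr_enorm => lb ub.
by rewrite -(ler_pM2r (mulr_gt0 t0 zp)); nra.
Unshelve. all: by end_near. Qed.

Lemma proximal_regular_subgradient f x z C :
  (\forall y \near x, dot z (y - x) - C * dot (y - x) (y - x) <= f y - f x) ->
  regular_subgradient f x z.
Proof.
move=> fz e e0; apply: filterS2 fz (near_enorm_scaled_lt x C e0) => y fy /ltW yx.
apply: le_trans fy; rewrite lerD2l lerN2 -sqr_enorm expr2 mulrA.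
by rewrite ler_wpM2r ?enorm_ge0.
Qed.

End RegularSubgradient.

Section GraphNormals.
Variables (R : realType) (n m : nat).
Implicit Types (G : 'rV[R]_n -> 'rV[R]_m) (x xb z : 'rV[R]_n) (u : 'rV[R]_m).
Implicit Types (a r L : R).

Definition lipschitz_ball G xb r L := forall x y,
  enorm (x - xb) < r -> enorm (y - xb) < r -> enorm (G x - G y) <= L * enorm (x - y).

Lemma lipschitz_ball_near G xb r L x : lipschitz_ball G xb r L -> enorm (x - xb) < r ->
  \forall y \near x, enorm (G y - G x) <= L * enorm (y - x).
Proof. by move=> GL xr; apply: filterS (near_enorm_lt xr) => y yr; exact: GL. Qed.

Lemma lipschitz_ball_continuous G xb r L x : lipschitz_ball G xb r L ->
  enorm (x - xb) < r -> {for x, continuous G}.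
Proof.
move=> GL xr; apply: (near_lipschitz_continuous (C := L)).
apply: filterS (lipschitz_ball_near GL xr) => y; apply: le_trans.
exact: mx_norm_le_enorm.
Qed.

Definition graph_normal G x u z :=
  regular_normal (graph G) (row_mx x (G x)) (row_mx z (- u)).

Lemma graph_normalZ G x u z a : 0 < a -> graph_normal G x u z ->
  graph_normal G x (a *: u) (a *: z).
Proof.
move=> a0 zu e e0; have [|d [d0 zud]] := zu (e / a); first exact: divr_gt0.
exists d; split=> // w Gw wd.
by rewrite -scalerN -scale_row_mx dotZl -ler_pdivlMl // mulrA [a^-1 * e]mulrC zud.
Qed.

Lemma graph_normal_subgradient G x u z L :
  (\forall y \near x, enorm (G y - G x) <= L * enorm (y - x)) ->
  graph_normal G x u z -> regular_subgradient (fun y => dot u (G y)) x z.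
Proof.
move=> GL zu e e0; have C0 : 0 < `|L| + 1 by rewrite ltr_wpDl.
have [|d [d0 zud]] := zu (e / (`|L| + 1)); first exact: divr_gt0.
apply: filterS2 GL (near_enorm_scaled_lt x (`|L| + 1) d0) => y Gy yd.
have wy : enorm (row_mx (y - x) (G y - G x)) <= (`|L| + 1) * enorm (y - x).
  apply: le_trans (enorm_row_mx_le _ _) _.
  by have := enorm_ge0 (y - x); have := ler_norm L; nra.
have := zud (row_mx y (G y)) (ex_intro _ y erefl).
rewrite sub_row_mx dot_row_mx dotNl -dotBr => zuy.
rewrite lerBlDr -lerBlDl; apply: le_trans (zuy (le_lt_trans wy yd)) _.
by rewrite mulrAC ler_pdivrMr // mulrAC -mulrA ler_wpM2l ?(ltW e0).
Qed.

Lemma subgradient_graph_normal G x u z :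
  regular_subgradient (fun y => dot u (G y)) x z -> graph_normal G x u z.
Proof.
move=> uz e e0; have /nbhs_enormP[d d0 zd] := uz e e0.
exists d; split=> // _ [y ->]; rewrite sub_row_mx dot_row_mx dotNl => yd.
have yw := enorm_le_row_mx (y - x) (G y - G x).
have := zd y (le_lt_trans yw yd); rewrite -dotBr.
by have := ler_wpM2l (ltW e0) yw; lra.
Qed.

Lemma graph_normal_enorm_le G xb r x u z L : 0 <= L -> lipschitz_ball G xb r L ->
  enorm (x - xb) < r -> graph_normal G x u z -> enorm z <= L * enorm u.
Proof.
move=> L0 GL xr; have Gx := lipschitz_ball_near GL xr.
move=> /(graph_normal_subgradient Gx).
apply: regular_subgradient_enorm_le; first by rewrite mulr_ge0 ?enorm_ge0.
apply: filterS Gx => y Gy; rewrite -dotBr; apply: le_trans (dot_le_enorm _ _) _.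
by rewrite -mulrA mulrCA ler_wpM2l ?enorm_ge0.
Qed.

Lemma coderivP G x u z : coderiv G x (G x) u z <->
  exists y us zs, [/\ y @ \oo --> x, G \o y @ \oo --> G x, us @ \oo --> u,
    zs @ \oo --> z & forall k : nat, graph_normal G (y k) (us k) (zs k)].
Proof.
split=> [[w [v [/choice[y wE] [vN [/seq_cvgP wx /seq_cvgP vz]]]]]|].
  move: wx vz; rewrite (funext wE) -(funext (fun k => hsubmxK (v k))).
  move=> /cvg_row_mx[yx Gyx] /cvg_row_mx[zsz usu].
  exists y, (fun k => - rsubmx (v k)), (fun k => lsubmx (v k)); split=> // [|k].
    by rewrite -[u]opprK; exact: cvgN.
  by rewrite /graph_normal opprK hsubmxK -wE.
case=> y [us [zs [yx Gyx usu zsz normal_k]]].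
exists (fun k => row_mx (y k) (G (y k))), (fun k => row_mx (zs k) (- us k)).
split=> [k|]; first by exists (y k).
split; first exact: normal_k.
by split; apply/seq_cvgP/cvg_row_mx; split=> //; exact: cvgN.
Qed.

Lemma graph_normal_coderiv G x u z : graph_normal G x u z -> coderiv G x (G x) u z.
Proof.
move=> zu; apply/coderivP.
exists (fun=> x), (fun=> u), (fun=> z).
by split; [exact: cvg_cst|exact: cvg_cst|exact: cvg_cst|exact: cvg_cst|].
Qed.

Lemma coderiv_enorm_le G xb r x u z L : 0 <= L -> lipschitz_ball G xb r L ->
  enorm (x - xb) < r -> coderiv G x (G x) u z -> enorm z <= L * enorm u.
Proof.
move=> L0 GL xr /coderivP[y [us [zs [yx _ usu zsz normal_k]]]].
have Lus : L * enorm (us k) @[k --> \oo] --> L * enorm u.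
  by apply: cvgM; [exact: cvg_cst|exact: cvg_enorm].
apply: (ler_cvg_to (cvg_enorm zsz) Lus).
have : \forall k \near \oo, enorm (y k - xb) < r by exact: yx (near_enorm_lt xr).
by apply: filterS => k yr; exact: graph_normal_enorm_le L0 GL yr (normal_k k).
Qed.

End GraphNormals.

Section Coercivity.
Variables (R : realType) (n : nat).
Implicit Types (F : 'rV[R]_n -> 'rV[R]_n -> Prop) (G : 'rV[R]_n -> 'rV[R]_n).
Implicit Types (x xb u z : 'rV[R]_n) (r L kappa : R).

Definition positive_definite F := forall u z, u != 0 -> F u z -> 0 < dot z u.

Definition coercive kappa F := forall u z, F u z -> kappa * dot u u <= dot z u.

Lemma not_coercive_unit F kappa :
  (forall a u z, 0 < a -> F u z -> F (a *: u) (a *: z)) -> ~ coercive kappa F ->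
  exists u z, [/\ F u z, enorm u = 1 & dot z u <= kappa].
Proof.
move=> FZ; apply: contra_notP => no_unit u z Fuz; rewrite leNgt; apply/negP => lt_uz.
have u0 : u != 0 by apply: contraTneq lt_uz => ->; rewrite !dot0r mulr0 ltxx.
have nu : 0 < (enorm u)^-1 by rewrite invr_gt0 enorm_gt0.
apply: no_unit; exists ((enorm u)^-1 *: u), ((enorm u)^-1 *: z); split; first exact: FZ.
  by rewrite enormZ gtr0_norm // mulVf ?enorm_eq0.
rewrite dotZl dotZr mulrA -expr2 exprVn sqr_enorm mulrC ler_pdivrMr ?ltW //.
by rewrite -sqr_enorm exprn_gt0 // -invr_gt0.
Qed.

Lemma not_coercive_graph_normal_seq G xb r : 0 < r ->
  ~ (exists2 kappa, 0 < kappa & \forall x \near xb, coercive kappa (graph_normal G x)) ->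
  exists x u z : nat -> 'rV[R]_n, [/\ x @ \oo --> xb, forall k, enorm (x k - xb) < r,
    forall k : nat, graph_normal G (x k) (u k) (z k), forall k, enorm (u k) = 1 &
    forall k, dot (z k) (u k) <= k.+1%:R^-1].
Proof.
move=> r0 not_coercive.
have /choice[p pP] k : exists p : 'rV[R]_n * 'rV[R]_n * 'rV[R]_n,
    [/\ enorm (p.1.1 - xb) < k.+1%:R^-1, enorm (p.1.1 - xb) < r,
        graph_normal G p.1.1 p.1.2 p.2, enorm p.1.2 = 1 & dot p.2 p.1.2 <= k.+1%:R^-1].
  have k0 : 0 < k.+1%:R^-1 :> R by rewrite invr_gt0.
  apply: contrapT => none; apply: not_coercive; exists k.+1%:R^-1 => //.
  near=> x; apply: contrapT => /not_coercive_unit[|u [z [zu u1 uz]]].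
    by move=> a u z; exact: graph_normalZ.
  by apply: none; exists (x, u, z); split=> //=; near: x; exact: near_enorm_center.
exists (fun k => (p k).1.1), (fun k => (p k).1.2), (fun k => (p k).2).
split=> [|k|k|k|k]; try by have [] := pP k.
by apply: cvg_enorm_harmonic => k; have [] := pP k.
Unshelve. all: by end_near. Qed.

(* If coercivity failed near [xb], a cluster point of unit normals violating it would be
   a limiting normal at [xb] contradicting positive definiteness. *)
Lemma coercive_graph_normal_near G xb r L : 0 < r -> 0 <= L -> lipschitz_ball G xb r L ->
  positive_definite (coderiv G xb (G xb)) ->
  exists2 kappa, 0 < kappa & \forall x \near xb, coercive kappa (graph_normal G x).
Proof.
move=> r0 L0 GL pd; apply: contrapT.
move=> /(not_coercive_graph_normal_seq r0)[x [u [z [xxb xr zu u1 uz]]]].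
have [k|l [g goo]] := @bounded_cvg_subseq _ _ (fun k => row_mx (z k) (u k)) (L + 1).
  apply: le_trans (enorm_row_mx_le _ _) _; rewrite u1 lerD2r.
  by have := graph_normal_enorm_le L0 GL (xr k) (zu k); rewrite u1 mulr1.
rewrite -[l]hsubmxK => /cvg_row_mx; set zl := lsubmx l; set ul := rsubmx l => -[zgl ugl].
have ul1 : enorm ul = 1.
  have : enorm (u (g k)) @[k --> \oo] --> (1 : R).
    by under eq_fun do rewrite u1; exact: cvg_cst.
  exact: cvg_unique (cvg_enorm ugl).
have zul : dot zl ul <= 0.
  apply: ler_cvg_to (cvg_dot zgl ugl) (cvg_comp _ _ goo (@cvg_harmonic R)) _.
  by near=> k; exact: uz.
suff : 0 < dot zl ul by rewrite ltNge zul.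
apply: pd; first by rewrite -enorm_gt0 ul1.
have xgxb : x \o g @ \oo --> xb by exact: cvg_comp goo xxb.
have xbr : enorm (xb - xb) < r by rewrite enorm_subrr.
apply/coderivP; exists (x \o g), (u \o g), (z \o g); split=> [||||k] //.
  exact: (continuous_cvg _ (lipschitz_ball_continuous GL xbr) xgxb).
exact: zu.
Unshelve. all: by end_near. Qed.

Lemma coercive_coderiv G x kappa :
  (\forall y \near x, coercive kappa (graph_normal G y)) ->
  coercive kappa (coderiv G x (G x)).
Proof.
move=> Gk u z /coderivP[y [us [zs [yx _ usu zsz normal_k]]]].
have kus : kappa * dot (us k) (us k) @[k --> \oo] --> kappa * dot u u.
  by apply: cvgM; [exact: cvg_cst|exact: cvg_dot].
apply: (ler_cvg_to kus (cvg_dot zsz usu)).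
have : \forall k \near \oo, coercive kappa (graph_normal G (y k)) by exact: yx Gk.
by apply: filterS => k; apply; exact: normal_k.
Qed.

Lemma coercive_coderiv_near G xb r L : 0 < r -> 0 <= L -> lipschitz_ball G xb r L ->
  positive_definite (coderiv G xb (G xb)) ->
  exists2 kappa, 0 < kappa & \forall x \near xb, coercive kappa (coderiv G x (G x)).
Proof.
move=> r0 L0 GL pd; have [kappa kappa0 Gk] := coercive_graph_normal_near r0 L0 GL pd.
exists kappa => //; have : \forall x \near xb, \forall y \near x,
  coercive kappa (graph_normal G y) by exact: near_join.
by apply: filterS => x; exact: coercive_coderiv.
Qed.

End Coercivity.

Section Penalization.
Variables (R : realType) (n : nat) (f : 'rV[R]_n -> R) (a b : 'rV[R]_n) (c N : R).
Implicit Types (x y xb : 'rV[R]_n) (l s t : R).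

(* [t] is the position along the segment and [x] a point near [a + t (b - a)];
   letting [x] leave the segment is what makes its minimality a subgradient condition. *)
Definition penalized t x : R :=
  f x - c * t + N * dot (x - (a + t *: (b - a))) (x - (a + t *: (b - a))).

Definition penalized_argmin xb rho t x := [/\ 0 <= t <= 1, enorm (x - xb) <= rho &
  forall s y, 0 <= s <= 1 -> enorm (y - xb) <= rho -> penalized t x <= penalized s y].

Lemma penalized_argmin_exists xb rho :
  (forall x, enorm (x - xb) <= rho -> {for x, continuous f}) -> enorm (a - xb) <= rho ->
  exists t x, penalized_argmin xb rho t x.
Proof.
move=> fc aD; set D : set (R * 'rV[R]_n) := `[0, 1] `*` [set y | enorm (y - xb) <= rho].
have D0 : D !=set0 by exists (0, a); split; rewrite //= in_itv /= lexx ler01.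
have cD : compact D.
  by apply: compact_setX; [exact: segment_compact|exact: compact_enorm_ball].
have penalized_c : {within D, continuous (fun p => penalized p.1 p.2)}.
  apply: continuous_in_subspaceT => -[t x] /set_mem[/= _ xD].
  have tp : p.1 @[p --> (t, x)] --> t by exact: cvg_fst.
  have xp : p.2 @[p --> (t, x)] --> x by exact: cvg_snd.
  have wp : p.2 - (a + p.1 *: (b - a)) @[p --> (t, x)] --> x - (a + t *: (b - a)).
    by apply: cvgB xp _; apply: cvgD; [exact: cvg_cst|exact: (cvgZ tp (cvg_cst _))].
  apply: cvgD; last by apply: cvgM; [exact: cvg_cst|exact: cvg_dot].
  apply: cvgB; last by apply: cvgM; [exact: cvg_cst|].
  exact: (continuous_cvg _ (fc x xD) xp).
have [[t x] /set_mem[/= t01 xD] tx_min] := compact_EVT_min D0 cD penalized_c.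
by exists t, x; split=> // s y s01 yD; apply: (tx_min (s, y)); apply/mem_set; split.
Qed.

Lemma penalized_min_dist t x l : 0 <= N -> 0 <= l ->
  f (a + t *: (b - a)) - f x <= l * enorm (x - (a + t *: (b - a))) ->
  penalized t x <= penalized t (a + t *: (b - a)) ->
  N * enorm (x - (a + t *: (b - a))) <= l.
Proof.
rewrite /penalized subrr dot0l -sqr_enorm; set w := enorm _ => N0 l0 f_le tx_le.
have [->|w0] := eqVneq w 0; first by rewrite mulr0.
by rewrite -(ler_pM2r (x := w)) ?lt0r ?w0 ?enorm_ge0 // -mulrA -expr2; lra.
Qed.

Lemma penalized_min_subgradient t x :
  (\forall y \near x, penalized t x <= penalized t y) ->
  regular_subgradient f x (- (2 * N) *: (x - (a + t *: (b - a)))).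
Proof.
rewrite /penalized; set p := a + _ => x_min.
apply: (@proximal_regular_subgradient _ _ _ _ _ N); apply: filterS x_min => y.
rewrite (_ : y - p = x - p + (y - x)) ?dot_sqrD ?dotZl; first by lra.
by rewrite [RHS]addrC subrKA.
Qed.

Lemma penalized_min_slope t x : 0 <= N -> 0 < t ->
  (forall s, 0 <= s <= t -> penalized t x <= penalized s x) ->
  dot (- (2 * N) *: (x - (a + t *: (b - a)))) (b - a) <= c.
Proof.
move=> N0 t0 t_min; apply/ler_addgt0Pr => e e0; set v := b - a; set w := x - _.
have C0 : 0 < N * dot v v + 1 by rewrite ltr_wpDl // mulr_ge0 ?dot_ge0.
pose h := Num.min t (e / (N * dot v v + 1)).
have h0 : 0 < h by rewrite lt_min t0 divr_gt0.
have [ht he] : h <= t /\ h <= e / (N * dot v v + 1) by rewrite !ge_min !lexx orbT.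
have := t_min (t - h); rewrite subr_ge0 ht lerBlDr lerDl (ltW h0) => /(_ isT).
rewrite /penalized -/v -/w (_ : x - (a + (t - h) *: v) = w + h *: v).
  rewrite dot_sqrD !dotZr dotZl dotZl => slope.
  by rewrite ler_pdivlMr // in he; rewrite -(ler_pM2l h0); nra.
by apply/rowP => i; rewrite /w !mxE; ring.
Qed.

Lemma penalized_end_lt_start x l : 0 < N -> f a - f x <= l * enorm (x - a) ->
  N * enorm (x - a) <= l -> l ^+ 2 < N * (c - (f b - f a)) ->
  penalized 1 b < penalized 0 x.
Proof.
rewrite /penalized scale0r addr0 scale1r subrKC subrr dot0l -sqr_enorm.
move=> N0 f_le dist_le l_lt; rewrite -(ltr_pM2l N0).
have : N * (f a - f x) <= N * (l * enorm (x - a)) by rewrite ler_pM2l.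
by have := enorm_ge0 (x - a); nra.
Qed.

End Penalization.

Section ApproximateMeanValue.
Variables (R : realType) (n : nat) (f : 'rV[R]_n -> R) (xb : 'rV[R]_n) (r l : R).
Hypothesis l0 : 0 <= l.
Hypothesis f_lip : forall x y, enorm (x - xb) < r -> enorm (y - xb) < r ->
  f y - f x <= l * enorm (y - x).

Let f_continuous x : enorm (x - xb) < r -> {for x, continuous f}.
Proof.
move=> xr; apply: (@near_lipschitz_continuous _ _ R^o f x l).
apply: filterS (near_enorm_lt xr) => y yr; rewrite ler_norml f_lip // andbT.
by rewrite lerNl opprB enorm_distC f_lip.
Qed.

(* The penalty forces [N |x - (a + t (b - a))| <= l], which keeps [x] off the sphere of
   radius [rho]; then [f b - f a < c] keeps [t] off 0. *)
Lemma penalized_argmin_interior a b c N m rho t x :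
  enorm (a - xb) <= m -> enorm (b - xb) <= m -> m < rho < r ->
  0 < N -> l < N * (rho - m) -> l ^+ 2 < N * (c - (f b - f a)) ->
  penalized_argmin f a b c N xb rho t x -> 0 < t /\ enorm (x - xb) < rho.
Proof.
move=> am bm /andP[m_rho rho_r] N0 N_rho N_c [t01 x_rho tx_min].
pose p := a + t *: (b - a); have pm : enorm (p - xb) <= m.
  by apply: le_trans (enorm_segment_le _ _ _ t01) _; rewrite ge_max am.
have p_rho := le_trans pm (ltW m_rho); have b_rho := le_trans bm (ltW m_rho).
have f_le : f p - f x <= l * enorm (x - p).
  by rewrite enorm_distC f_lip // (le_lt_trans _ rho_r).
have dist_le := penalized_min_dist (ltW N0) l0 f_le (tx_min t p t01 p_rho).
split; last first.
  have : enorm (x - p) < rho - m; last by have := ler_dist_enormD x p xb; lra.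
  by rewrite -(ltr_pM2l N0) (le_lt_trans dist_le).
rewrite lt0r (andP t01).1 andbT; apply/eqP => t0.
have b_ge : penalized f a b c N t x <= penalized f a b c N 1 b.
  by apply: tx_min; [rewrite ler01 lexx|].
move: dist_le f_le b_ge; rewrite /p t0 scale0r addr0 => dist_le f_le; apply/negP.
by rewrite -ltNge; exact: penalized_end_lt_start N0 f_le dist_le N_c.
Qed.

Lemma approximate_mean_value a b c :
  enorm (a - xb) < r -> enorm (b - xb) < r -> f b - f a < c ->
  exists x z, [/\ enorm (x - xb) < r, regular_subgradient f x z & dot z (b - a) <= c].
Proof.
move=> ar br fabc; pose m := Num.max (enorm (a - xb)) (enorm (b - xb)).
have [am bm] : enorm (a - xb) <= m /\ enorm (b - xb) <= m by rewrite !le_max !lexx orbT.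
have mr : m < r by rewrite gt_max ar br.
pose rho := (m + r) / 2; have [m_rho rho_r] : m < rho /\ rho < r by rewrite /rho; split; lra.
pose delta := c - (f b - f a); have delta0 : 0 < delta by rewrite subr_gt0.
pose N := Num.max (l / (rho - m)) (l ^+ 2 / delta) + 1.
have N_rho : l / (rho - m) < N by rewrite ltr_pwDr // le_max lexx.
have N_delta : l ^+ 2 / delta < N by rewrite ltr_pwDr // le_max lexx orbT.
have N0 : 0 < N by apply: le_lt_trans N_rho; rewrite divr_ge0 // subr_ge0 ltW.
have [y y_rho||t [x tx_argmin]] := @penalized_argmin_exists _ _ f a b c N xb rho.
- by apply: f_continuous; exact: le_lt_trans rho_r.
- exact: le_trans am (ltW m_rho).
have [|||t0 x_lt_rho] := penalized_argmin_interior am bm _ N0 _ _ tx_argmin.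
- by rewrite m_rho.
- by rewrite -ltr_pdivrMr ?subr_gt0.
- by rewrite -ltr_pdivrMr.
case: tx_argmin => /andP[_ t1] x_rho tx_min.
exists x, (- (2 * N) *: (x - (a + t *: (b - a)))); split; first exact: le_lt_trans rho_r.
  apply: penalized_min_subgradient; apply: filterS (near_enorm_lt x_lt_rho) => y /ltW.
  by apply: tx_min; rewrite (ltW t0).
apply: penalized_min_slope (ltW N0) t0 _ => s /andP[s0 st]; apply: tx_min => //.
by rewrite s0 (le_trans st).
Qed.

End ApproximateMeanValue.

Section StrongMonotonicity.
Variables (R : realType) (n : nat).

Definition strongly_monotone_ball (G : 'rV[R]_n -> 'rV[R]_n) xb r kappa := forall x y,
  enorm (x - xb) < r -> enorm (y - xb) < r ->
  kappa * dot (y - x) (y - x) <= dot (G y - G x) (y - x).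

Lemma coercive_strongly_monotone (G : 'rV[R]_n -> 'rV[R]_n) xb r L kappa :
  0 <= L -> lipschitz_ball G xb r L ->
  (forall x, enorm (x - xb) < r -> coercive kappa (coderiv G x (G x))) ->
  strongly_monotone_ball G xb r kappa.
Proof.
move=> L0 GL Gk a b ar br; set v := b - a; rewrite leNgt; apply/negP => lt_k.
pose c := (dot (G b - G a) v + kappa * dot v v) / 2.
have [|x y xr yr||x [z [xr vGz zv]]] :=
  @approximate_mean_value _ _ (fun y => dot v (G y)) xb r (enorm v * L) _ _ a b c ar br.
- by rewrite mulr_ge0 ?enorm_ge0.
- rewrite -dotBr; apply: le_trans (dot_le_enorm _ _) _.
  by rewrite -mulrA ler_wpM2l ?enorm_ge0 // GL.
- by rewrite -dotBr dotC /c; lra.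
have := Gk x xr v z (graph_normal_coderiv (subgradient_graph_normal vGz)).
by move: zv; rewrite /c; lra.
Qed.

End StrongMonotonicity.

Section GradientEstimates.
Variables (R : realType) (n : nat) (phi : 'rV[R]_n -> R) (grad : 'rV[R]_n -> 'rV[R]_n).
Variables (xb : 'rV[R]_n) (r : R).
Hypothesis phi_grad : forall x, is_gradient phi x (grad x).
Implicit Types (x v : 'rV[R]_n) (L kappa t : R).

Let segment_in_ball x v t : enorm (x - xb) < r -> enorm (x + v - xb) < r -> 0 < t < 1 ->
  enorm (x + t *: v - xb) < r.
Proof.
move=> xr xvr /andP[t0 t1]; have := @enorm_segment_le _ _ x (x + v) xb t.
rewrite addrKl (ltW t0) (ltW t1) => /(_ isT)/le_lt_trans; apply.
by rewrite gt_max xr xvr.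
Qed.

Lemma lipschitz_gradient_le L x v : lipschitz_ball grad xb r L ->
  enorm (x - xb) < r -> enorm (x + v - xb) < r ->
  phi (x + v) - phi x <= dot (grad x) v + L / 2 * dot v v.
Proof.
move=> gradL xr xvr.
have slope t : 0 < t < 1 -> - L * t * dot v v <= dot (- grad (x + t *: v) - - grad x) v.
  move=> t01; have t0 : 0 < t by case/andP: t01.
  rewrite -opprD dotNl !mulNr lerN2; apply: le_trans (dot_le_enorm _ _) _.
  have := gradL _ _ (segment_in_ball xr xvr t01) xr.
  rewrite addrKl enormZ (gtr0_norm t0) -sqr_enorm expr2 !mulrA.
  by move=> grad_le; rewrite ler_wpM2r ?enorm_ge0.
have := gradient_quadratic_le (fun y => is_gradientN (phi_grad y)) slope.
by rewrite dotNl; lra.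
Qed.

Lemma strongly_monotone_gradient_ge kappa x v : strongly_monotone_ball grad xb r kappa ->
  enorm (x - xb) < r -> enorm (x + v - xb) < r ->
  dot (grad x) v + kappa / 2 * dot v v <= phi (x + v) - phi x.
Proof.
move=> mono xr xvr; apply: gradient_quadratic_le => // t t01.
have t0 : 0 < t by case/andP: t01.
have := mono _ _ xr (segment_in_ball xr xvr t01).
by rewrite addrKl !dotZl !dotZr mulrCA ler_pM2l // mulrA.
Qed.

End GradientEstimates.

Section TiltStability.
Variables (R : realType) (n : nat) (phi : 'rV[R]_n -> R) (grad : 'rV[R]_n -> 'rV[R]_n).
Variables (xb : 'rV[R]_n) (r kappa : R).
Hypothesis phi_grad : forall x, is_gradient phi x (grad x).
Hypothesis kappa0 : 0 < kappa.
Hypothesis mono : strongly_monotone_ball grad xb r kappa.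
Implicit Types (x y v w : 'rV[R]_n) (gamma : R).

Lemma tilt_argmin_exists gamma v : 0 <= gamma -> exists x, tilt_argmin phi gamma xb v x.
Proof.
move=> gamma0; have [|||x /set_mem xg x_min] :=
  @compact_EVT_min _ R (fun x => phi x - dot v x) [set x | enorm (x - xb) <= gamma].
- by exists xb; rewrite /= enorm_subrr.
- exact: compact_enorm_ball.
- apply: continuous_subspaceT => x; apply: continuousB.
    exact: (is_gradient_continuous (phi_grad x)).
  exact: continuous_dot.
by exists x; split=> // y yg; apply: x_min; exact: mem_set.
Qed.

Lemma tilt_argmin_variational gamma v x y : tilt_argmin phi gamma xb v x ->
  enorm (y - xb) <= gamma -> dot v (y - x) <= dot (grad x) (y - x).
Proof.
move=> [xg x_min] yg; rewrite -subr_ge0 -dotBl.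
apply: (is_gradient_dir_min (is_gradient_tilt v (phi_grad x))).
near=> t; apply: x_min; apply: le_trans (enorm_segment_le _ _ _ _) _.
  by apply/andP; split; [|near: t; exact: nbhs_right_le].
by rewrite ge_max xg.
Unshelve. all: by end_near. Qed.

Lemma tilt_argmin_lipschitz gamma v w x y : gamma < r ->
  tilt_argmin phi gamma xb v x -> tilt_argmin phi gamma xb w y ->
  enorm (x - y) <= kappa^-1 * enorm (v - w).
Proof.
move=> gr x_min y_min; have [xg _] := x_min; have [yg _] := y_min.
have [->|xy] := eqVneq x y.
  by rewrite enorm_subrr mulr_ge0 ?enorm_ge0 // invr_ge0 ltW.
have xy0 : 0 < enorm (x - y) by rewrite enorm_gt0 subr_eq0.
rewrite ler_pdivlMl // -(ler_pM2r xy0) -mulrA -expr2 sqr_enorm.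
apply: le_trans (mono (le_lt_trans yg gr) (le_lt_trans xg gr)) _.
apply: le_trans (dot_le_enorm _ _).
have := tilt_argmin_variational x_min yg; have := tilt_argmin_variational y_min xg.
by rewrite -(opprB x y) !dotNr !dotBl; lra.
Qed.

Lemma stationary_tilt_argmin gamma : 0 < gamma < r -> grad xb = 0 ->
  tilt_argmin phi gamma xb 0 xb.
Proof.
move=> /andP[gamma0 gr] xb0; have xbg : enorm (xb - xb) <= gamma by rewrite enorm_subrr ltW.
have [x x_min] := tilt_argmin_exists 0 (ltW gamma0); have [xg _] := x_min.
suff xE : x = xb by rewrite xE in x_min.
have := tilt_argmin_variational x_min xbg.
have := mono (le_lt_trans xg gr) (le_lt_trans xbg gr).
rewrite xb0 sub0r dotNl dot0l => kx gx; apply/eqP.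
rewrite eq_sym -subr_eq0 -enorm_eq0 -sqrf_eq0 sqr_enorm eq_le dot_ge0 andbT.
by rewrite -(pmulr_rle0 _ kappa0); lra.
Qed.

Lemma strongly_monotone_tilt_stable : 0 < r -> grad xb = 0 -> tilt_stable phi xb.
Proof.
move=> r0 xb0; pose gamma := r / 2.
have /andP[gamma0 gr] : 0 < gamma < r by rewrite /gamma; apply/andP; split; lra.
have [M M_min] := choice (fun v => tilt_argmin_exists v (ltW gamma0)).
have M_uniq v x : tilt_argmin phi gamma xb v x -> x = M v.
  move=> x_min; apply/eqP; rewrite -subr_eq0 -enorm_eq0 eq_le enorm_ge0 andbT.
  by have := tilt_argmin_lipschitz gr x_min (M_min v); rewrite enorm_subrr mulr0.
exists gamma; split=> //; exists 1; split=> //; exists M, kappa^-1.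
split=> [v _ x|]; first by split=> [/M_uniq|->].
split=> [v w _ _|]; first exact: tilt_argmin_lipschitz (M_min v) (M_min w).
by apply/esym/M_uniq/stationary_tilt_argmin; rewrite ?gamma0.
Qed.

End TiltStability.

Section NewtonSteps.
Variables (R : realType) (n : nat) (phi : 'rV[R]_n -> R) (grad : 'rV[R]_n -> 'rV[R]_n).
Variables (sigma beta : R).
Hypotheses (sigma0 : 0 < sigma) (sigma1 : sigma < 1) (beta0 : 0 < beta) (beta1 : beta < 1).
Implicit Types (x y d : 'rV[R]_n) (t tau : R).

Definition armijo x d t := phi (x + t *: d) <= phi x + sigma * t * dot (grad x) d.

Lemma backtracking_ge (P : R -> Prop) tau j :
  (forall t, 0 < t <= tau -> P t) -> (forall i, (i < j)%N -> ~ P (beta ^+ i)) ->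
  Num.min 1 (beta * tau) <= beta ^+ j.
Proof.
move=> Ptau; case: j => [_|j failed]; first by rewrite expr0 ge_min lexx.
rewrite ge_min exprS ler_pM2l //; apply/orP; right; rewrite leNgt; apply/negP => lt_tau.
by apply: (failed j) => //; apply: Ptau; rewrite exprn_gt0 //= ltW.
Qed.

Lemma gdn_step_le x y : positive_definite (hess2 grad x) ->
  gdn_step phi grad sigma beta x y -> phi y <= phi x.
Proof.
rewrite /gdn_step => pd; case: eqP => [_ -> //|_ [d [dN [j [_ [le_y ->]]]]]].
apply: le_trans le_y _; rewrite gerDl mulr_ge0_le0 //.
  by rewrite mulr_ge0 ?exprn_ge0 // ltW.
have [->|d0] := eqVneq d 0; first by rewrite dot0r.
by have := pd _ _ d0 dN; rewrite dotNl oppr_gt0 => /ltW.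
Qed.

Section Ball.
Variables (xb : 'rV[R]_n) (r kappa L : R).
Hypotheses (r0 : 0 < r) (kappa0 : 0 < kappa) (L0 : 0 < L).
Hypothesis phi_grad : forall x, is_gradient phi x (grad x).
Hypothesis gradL : lipschitz_ball grad xb r L.
Hypothesis hess_coercive : forall x, enorm (x - xb) < r -> coercive kappa (hess2 grad x).

Lemma newton_direction_descent x d : enorm (x - xb) < r -> hess2 grad x d (- grad x) ->
  kappa * enorm d ^+ 2 <= - dot (grad x) d.
Proof. by move=> xr /(hess_coercive xr); rewrite dotNl sqr_enorm. Qed.

Lemma enorm_grad_le_newton x d : enorm (x - xb) < r -> hess2 grad x d (- grad x) ->
  enorm (grad x) <= L * enorm d.
Proof. by move=> xr /(coderiv_enorm_le (ltW L0) gradL xr); rewrite enormN. Qed.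

Lemma enorm_newton_le_grad x d : enorm (x - xb) < r -> hess2 grad x d (- grad x) ->
  kappa * enorm d <= enorm (grad x).
Proof.
move=> xr dN; have [->|d0] := eqVneq d 0; first by rewrite enorm0 mulr0 enorm_ge0.
have d_gt0 : 0 < enorm d by rewrite enorm_gt0.
rewrite -(ler_pM2r d_gt0) -mulrA -expr2 (le_trans (newton_direction_descent xr dN)) //.
by rewrite -dotNl (le_trans (dot_le_enorm _ _)) // enormN.
Qed.

Lemma gdn_step_dist x y : enorm (x - xb) < r ->
  gdn_step phi grad sigma beta x y -> kappa * enorm (y - x) <= enorm (grad x).
Proof.
rewrite /gdn_step => xr; case: eqP => [_ ->|_ [d [dN [j [_ [_ ->]]]]]].
  by rewrite enorm_subrr mulr0 enorm_ge0.
apply: le_trans (enorm_newton_le_grad xr dN).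
rewrite addrKl enormZ ler_wpM2l ?(ltW kappa0) // ger0_norm ?exprn_ge0 ?(ltW beta0) //.
by rewrite ler_piMl ?enorm_ge0 // exprn_ile1 // ltW.
Qed.

Lemma armijo_of_small_step x d t : hess2 grad x d (- grad x) -> 0 < t ->
  enorm (x - xb) < r -> enorm (x + t *: d - xb) < r -> L * t <= 2 * kappa * (1 - sigma) ->
  armijo x d t.
Proof.
move=> dN t0 xr tr tL; have kd := newton_direction_descent xr dN.
have := lipschitz_gradient_le phi_grad gradL xr tr.
rewrite /armijo dotZr dotZl dotZr -sqr_enorm => descent.
have Ltd : t * (L * t * enorm d ^+ 2) <= t * (2 * kappa * (1 - sigma) * enorm d ^+ 2).
  by rewrite ler_pM2l // ler_wpM2r ?sqr_ge0.
have ksd : t * (1 - sigma) * (kappa * enorm d ^+ 2) <= t * (1 - sigma) * - dot (grad x) d.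
  by rewrite ler_wpM2l // mulr_ge0 ?subr_ge0 // ltW.
by lra.
Qed.

Lemma newton_direction_bounded : exists2 D : R, 0 < D &
  forall x d, enorm (x - xb) < r -> hess2 grad x d (- grad x) -> enorm d <= D.
Proof.
exists ((enorm (grad xb) + L * r) / kappa).
  by rewrite divr_gt0 // ltr_wpDl ?enorm_ge0 // mulr_gt0.
move=> x d xr dN; rewrite ler_pdivlMr // mulrC.
apply: le_trans (enorm_newton_le_grad xr dN) _.
have xbr : enorm (xb - xb) < r by rewrite enorm_subrr.
have := gradL xr xbr; have := ler_enormD (grad x - grad xb) (grad xb).
by rewrite subrK; have := ler_wpM2l (ltW L0) (ltW xr); lra.
Qed.

Lemma armijo_uniform : exists2 tau : R, 0 < tau & forall x d t, enorm (x - xb) < r / 2 ->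
  hess2 grad x d (- grad x) -> 0 < t <= tau -> armijo x d t.
Proof.
have [D D0 dD] := newton_direction_bounded.
exists (Num.min (2 * kappa * (1 - sigma) / L) (r / 2 / D)).
  by rewrite lt_min !divr_gt0 ?mulr_gt0 ?subr_gt0 ?mulr_gt0.
move=> x d t xr2 dN /andP[t0]; rewrite le_min (ler_pdivlMr _ _ L0) (ler_pdivlMr _ _ D0).
rewrite mulrC => /andP[tL tD].
have xr : enorm (x - xb) < r by move: r0; lra.
apply: armijo_of_small_step => //.
rewrite addrAC; apply: le_lt_trans (ler_enormD _ _) _; rewrite enormZ gtr0_norm //.
by have := ler_wpM2l (ltW t0) (dD x d xr dN); lra.
Qed.

Lemma gdn_sufficient_decrease : exists2 c : R, 0 < c &
  forall x y, enorm (x - xb) < r / 2 -> gdn_step phi grad sigma beta x y ->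
  c * enorm (grad x) ^+ 2 <= phi x - phi y.
Proof.
have [tau tau0 tau_armijo] := armijo_uniform; pose tau1 := Num.min 1 (beta * tau).
have tau10 : 0 < tau1 by rewrite lt_min ltr01 mulr_gt0.
exists (sigma * tau1 * kappa / L ^+ 2); first by rewrite !(divr_gt0, mulr_gt0, exprn_gt0).
move=> x y xr2; have xr : enorm (x - xb) < r by move: r0; lra.
rewrite /gdn_step; case: eqP => [-> ->|_ [d [dN [j [failed [le_y ->]]]]]].
  by rewrite enorm0 expr0n mulr0 subrr.
have tau1j : tau1 <= beta ^+ j.
  apply: (@backtracking_ge (armijo x d)) => [t|i /failed]; first exact: tau_armijo.
  by rewrite ltNge => /negP.
have gd2 : enorm (grad x) ^+ 2 / L ^+ 2 <= enorm d ^+ 2.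
  rewrite ler_pdivrMr ?exprn_gt0 // mulrC -exprMn.
  rewrite lerXn2r ?nnegrE ?mulr_ge0 ?enorm_ge0 ?(ltW L0) //.
  exact: enorm_grad_le_newton xr dN.
have kgd : kappa * (enorm (grad x) ^+ 2 / L ^+ 2) <= - dot (grad x) d.
  by apply: le_trans (newton_direction_descent xr dN); rewrite ler_wpM2l // ltW.
rewrite (_ : _ * _ = sigma * (tau1 * (kappa * (enorm (grad x) ^+ 2 / L ^+ 2)))).
  apply: (@le_trans _ _ (sigma * (beta ^+ j * - dot (grad x) d))); last by lra.
  rewrite ler_pM2l // ler_pM ?(ltW tau10) // mulr_ge0 ?(ltW kappa0) //.
  by rewrite divr_ge0 ?sqr_ge0.
by field; rewrite gt_eqF.
Qed.

End Ball.
End NewtonSteps.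

Section LyapunovConvergence.
Variables (R : realType) (n : nat).

(* Near [xb] the values of [phi] control the distance to [xb] and decrease along the
   sequence, so an iterate close enough to [xb] traps all later ones. *)
Lemma lyapunov_cluster_cvg (phi : 'rV[R]_n -> R) (x : nat -> 'rV[R]_n) xb g (r m C : R) :
  0 < r -> 0 < m -> 0 <= C -> {for xb, continuous phi} ->
  (forall y, enorm (y - xb) < r -> m * enorm (y - xb) ^+ 2 <= phi y - phi xb) ->
  (forall k, phi (x k.+1) <= phi (x k)) ->
  (forall k, enorm (x k - xb) < r -> enorm (x k.+1 - x k) <= C * enorm (x k - xb)) ->
  x (g k) @[k --> \oo] --> xb -> seq_cvg x xb.
Proof.
move=> r0 m0 C0 phi_c growth phi_decr steps xg eps eps0.
pose e := Num.min eps (r / (1 + C)); have C1 : 0 < 1 + C by rewrite ltr_wpDr.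
have e0 : 0 < e by rewrite lt_min eps0 divr_gt0.
have e_eps : e <= eps by rewrite ge_min lexx.
have eC : e * (1 + C) <= r by rewrite -ler_pdivlMr // ge_min lexx orbT.
have level0 : 0 < m * e ^+ 2 by rewrite mulr_gt0 ?exprn_gt0.
near \oo => i.
suff trap k : enorm (x (g i + k)%N - xb) < e /\ phi (x (g i + k)%N) - phi xb < m * e ^+ 2.
  exists (g i) => k /subnKC <-; have [ke _] := trap (k - g i)%N.
  exact: lt_le_trans e_eps.
elim: k => [|k]; rewrite ?addn0 ?addnS; last set j := (g i + k)%N.
  split; near: i; first exact: (xg _ (near_enorm_center xb e0)).
  have phi_xg : phi (x (g i)) @[i --> \oo] --> phi xb.
    exact: (continuous_cvg _ phi_c xg).
  by under eq_near do rewrite ltrBlDr; apply: (cvgr_lt _ phi_xg); rewrite ltrDr.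
move=> [ke kl].
have eCe : e * C >= 0 by rewrite mulr_ge0 // ltW.
have kr : enorm (x j - xb) < r by lra.
have k1r : enorm (x j.+1 - xb) < r.
  have := ler_dist_enormD (x j.+1) (x j) xb; have := steps j kr.
  by have := ler_wpM2l C0 (ltW ke); lra.
have k1l : phi (x j.+1) - phi xb < m * e ^+ 2 by have := phi_decr j; lra.
split=> //; have := le_lt_trans (growth _ k1r) k1l.
by rewrite ltr_pM2l // ltr_pXn2r ?nnegrE ?enorm_ge0 // ltW.
Unshelve. all: by end_near. Qed.

End LyapunovConvergence.

Section Convergence.
Variables (R : realType) (n : nat) (phi : 'rV[R]_n -> R) (grad : 'rV[R]_n -> 'rV[R]_n).

Lemma C11_positive_definite_ball xb : C11 phi grad -> positive_definite (hess2 grad xb) ->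
  exists r kappa L : R, [/\ 0 < r, 0 < kappa, 0 < L, lipschitz_ball grad xb r L &
    forall x, enorm (x - xb) < r -> coercive kappa (hess2 grad x)].
Proof.
move=> [_ /(_ xb)[r [r0 [L gradL]]]] pd; have L0 : 0 < `|L| + 1 by rewrite ltr_wpDl.
have gradL1 : lipschitz_ball grad xb r (`|L| + 1).
  move=> x y xr yr; apply: le_trans (gradL x y xr yr) _.
  by rewrite ler_wpM2r ?enorm_ge0 // ler_wpDr // ler_norm.
have [kappa kappa0 /nbhs_enormP[e e0 hess_kappa]] :=
  coercive_coderiv_near r0 (ltW L0) gradL1 pd.
exists (Num.min r e), kappa, (`|L| + 1); split=> // [|x y|x]; rewrite ?lt_min ?r0 //.
  by move=> /andP[xr _] /andP[yr _]; exact: gradL1.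
by case/andP=> _; exact: hess_kappa.
Qed.

Variables (sigma beta : R) (x0 : 'rV[R]_n) (xs : nat -> 'rV[R]_n).
Hypotheses (sigma0 : 0 < sigma) (sigma1 : sigma < 1) (beta0 : 0 < beta) (beta1 : beta < 1).
Hypothesis phi_C11 : C11 phi grad.
Hypothesis hess_pd : forall x, phi x <= phi x0 -> positive_definite (hess2 grad x).
Hypothesis xs_gdn : gdn_sequence phi grad sigma beta x0 xs.

Let phi_grad : forall x, is_gradient phi x (grad x) := phi_C11.1.

Lemma gdn_level k : phi (xs k) <= phi x0.
Proof.
have [xs0 step] := xs_gdn; elim: k => [|k IH]; first by rewrite xs0.
exact: le_trans (gdn_step_le sigma0 beta0 (hess_pd IH) (step k)) IH.
Qed.

Lemma gdn_nonincreasing : nonincreasing_seq (phi \o xs).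
Proof.
apply/nonincreasing_seqP => k; have [_ step] := xs_gdn.
exact: (gdn_step_le sigma0 beta0 (hess_pd (gdn_level k)) (step k)).
Qed.

Variables (xb : 'rV[R]_n) (g : nat -> nat).
Hypotheses (g_infty : g @ \oo --> \oo) (xsg_xb : xs \o g @ \oo --> xb).

Let phi_xsg : phi (xs (g k)) @[k --> \oo] --> phi xb.
Proof. exact: (continuous_cvg _ (is_gradient_continuous (phi_grad xb)) xsg_xb). Qed.

Lemma cluster_value_le k : phi xb <= phi (xs k).
Proof.
apply: (cvgr_to_le phi_xsg).
have : \forall j \near \oo, (k <= g j)%N by exact: (g_infty (nbhs_infty_ge k)).
by apply: filterS => j; exact: gdn_nonincreasing.
Qed.

Lemma cluster_level : phi xb <= phi x0.
Proof. exact: le_trans (cluster_value_le 0) (gdn_level 0). Qed.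

Variables (r kappa L : R).
Hypotheses (r0 : 0 < r) (kappa0 : 0 < kappa) (L0 : 0 < L).
Hypothesis gradL : lipschitz_ball grad xb r L.
Hypothesis hess_coercive : forall x, enorm (x - xb) < r -> coercive kappa (hess2 grad x).

Let xbr : enorm (xb - xb) < r. Proof. by rewrite enorm_subrr. Qed.

Lemma cluster_stationary : grad xb = 0.
Proof.
have [c c0 decrease] := gdn_sufficient_decrease sigma0 sigma1 beta0 r0 kappa0 L0 phi_grad
  gradL hess_coercive.
have grad_xsg : grad (xs (g k)) @[k --> \oo] --> grad xb.
  exact: (continuous_cvg _ (lipschitz_ball_continuous gradL xbr) xsg_xb).
apply/eqP; rewrite -enorm_eq0 -sqrf_eq0 eq_le sqr_ge0 andbT -(pmulr_rle0 _ c0).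
rewrite sqr_enorm -(subrr (phi xb)).
have grad_cvg : c * dot (grad (xs (g k))) (grad (xs (g k))) @[k --> \oo] -->
    c * dot (grad xb) (grad xb).
  by apply: cvgM; [exact: cvg_cst|exact: cvg_dot].
have gap_cvg : phi (xs (g k)) - phi xb @[k --> \oo] --> phi xb - phi xb.
  by apply: cvgB; [exact: phi_xsg|exact: cvg_cst].
apply: (ler_cvg_to grad_cvg gap_cvg).
have : \forall k \near \oo, enorm (xs (g k) - xb) < r / 2.
  by apply: (xsg_xb (near_enorm_center xb _)); rewrite divr_gt0.
apply: filterS => k xk; have [_ step] := xs_gdn; rewrite -sqr_enorm.
apply: le_trans (decrease _ _ xk (step (g k))) _.
by rewrite lerD2l lerN2 cluster_value_le.
Qed.

Lemma gdn_cvg_cluster : seq_cvg xs xb.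
Proof.
apply: (@lyapunov_cluster_cvg _ _ phi _ _ g r (kappa / 2) (L / kappa)) => //.
- by rewrite divr_gt0.
- by rewrite divr_ge0 // ltW.
- exact: is_gradient_continuous (phi_grad xb).
- move=> x xr; have mono := coercive_strongly_monotone (ltW L0) gradL hess_coercive.
  have := strongly_monotone_gradient_ge (v := x - xb) phi_grad mono xbr.
  by rewrite subrKC cluster_stationary dot0l add0r sqr_enorm; apply.
- by move=> k; exact: gdn_nonincreasing (leqnSn k).
move=> k kr; have [_ step] := xs_gdn.
have := gdn_step_dist beta0 beta1 kappa0 hess_coercive kr (step k).
have := gradL kr xbr; rewrite cluster_stationary subr0 => grad_le step_le.
by rewrite mulrAC ler_pdivlMr // mulrC (le_trans step_le).
Qed.

End Convergence.

Theorem theorem3p7 (R : realType) (n : nat) (phi : 'rV[R]_n -> R)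
  (grad : 'rV[R]_n -> 'rV[R]_n) (x0 : 'rV[R]_n) (sigma beta : R) :
  C11 phi grad ->
  (forall x, phi x <= phi x0 ->
     forall u z, u != 0 -> hess2 grad x u z -> 0 < dot z u) ->
  (exists M : R, forall x, phi x <= phi x0 -> enorm x <= M) ->
  0 < sigma -> sigma < 1 / 2 -> 0 < beta -> beta < 1 ->
  forall xs : nat -> 'rV[R]_n, gdn_sequence phi grad sigma beta x0 xs ->
  exists xb : 'rV[R]_n, seq_cvg xs xb /\ tilt_stable phi xb.
Proof.
move=> phi_C11 pd [M level_M] sigma0 sigma_half beta0 beta1 xs xs_gdn.
have sigma1 : sigma < 1 by lra.
have [k|xb [g g_infty xsg_xb]] := @bounded_cvg_subseq _ _ xs M.
  exact: level_M (gdn_level sigma0 beta0 pd xs_gdn k).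
have xb_pd := pd xb (cluster_level sigma0 beta0 phi_C11 pd xs_gdn g_infty xsg_xb).
have [r [kappa [L [r0 kappa0 L0 gradL hess_coercive]]]] :=
  C11_positive_definite_ball phi_C11 xb_pd.
exists xb; split.
  exact: (gdn_cvg_cluster sigma0 sigma1 beta0 beta1 phi_C11 pd xs_gdn g_infty xsg_xb
    r0 kappa0 L0 gradL hess_coercive).
have mono := coercive_strongly_monotone (ltW L0) gradL hess_coercive.
apply: (strongly_monotone_tilt_stable phi_C11.1 kappa0 mono r0).
exact: (cluster_stationary sigma0 sigma1 beta0 phi_C11 pd xs_gdn g_infty xsg_xb
  r0 kappa0 L0 gradL hess_coercive).
Qed.
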